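(* Let $k\in\{1,\dots,14\}$ and $l\in\{1,2\}$, and assume that there exists $m\in\mathbb{N}$ such that $$\frac{\gamma\nu_{l,2}+\bar a_l}{\gamma\mu_{k,1}+a_k}=(m+1)^2 .$$ Assume moreover that $$2\big(2+(m+1)\pi\big)d_{l,k}<3\pi(m+1)^3b_k .$$ Then there exist $E_k^l>0$ and a strictly increasing function $\Lambda:[0,\infty)\to[0,\infty)$ with $\Lambda(0)=0$ such that the $k$-th longitudinal mode $\overline\varphi_k$ at energy $E=E(\phi_0^k,\phi_1^k)>0$ is stable with respect to the $l$-th torsional mode provided that $$E\le E_k^l$$ or, equivalently, provided that $$\|\overline\varphi_k\|_\infty^2\le\Lambda(E_k^l).$$
   Context: $\mathbb{N}=\{0,1,2,\dots\}$. Constants. $\sigma=0.2$, $\ell=\frac{\pi}{150}$, and $\gamma>0$ is a fixed real constant. For an integer $k\ge1$: - $\mu_{k,1}$ is the unique $\lambda\in((1-\sigma)^2k^4,k^4)$ such that $$\sqrt{k^2-\lambda^{1/2}}\big(\lambda^{1/2}+(1-\sigma)k^2\big)^2\tanh\big(\ell\sqrt{k^2-\lambda^{1/2}}\big)=\sqrt{k^2+\lambda^{1/2}}\big(\lambda^{1/2}-(1-\sigma)k^2\big)^2\tanh\big(\ell\sqrt{k^2+\lambda^{1/2}}\big).$$ - $\nu_{k,2}$ is the smallest $\lambda>k^4$ such that $$\sqrt{\lambda^{1/2}-k^2}\big(\lambda^{1/2}+(1-\sigma)k^2\big)^2\tanh\big(\ell\sqrt{\lambda^{1/2}+k^2}\big)=\sqrt{\lambda^{1/2}+k^2}\big(\lambda^{1/2}-(1-\sigma)k^2\big)^2\tan\big(\ell\sqrt{\lambda^{1/2}-k^2}\big).$$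 Put $\beta_k^{\pm}=k^2\pm\mu_{k,1}^{1/2}$ ($k=1,\dots,14$), $\alpha_k^{\pm}=\nu_{k,2}^{1/2}\pm k^2$ ($k=1,2$) and $$v_k(y)=\Big[\tfrac{k^2}{5}-\beta_k^-\Big]\frac{\cosh(y\sqrt{\beta_k^+})}{\cosh(\frac{\pi}{150}\sqrt{\beta_k^+})}+\Big[\beta_k^+-\tfrac{k^2}{5}\Big]\frac{\cosh(y\sqrt{\beta_k^-})}{\cosh(\frac{\pi}{150}\sqrt{\beta_k^-})}\quad(k=1,\dots,14),$$ $$\theta_k(y)=\Big[\tfrac{k^2}{5}+\alpha_k^-\Big]\frac{\sinh(y\sqrt{\alpha_k^+})}{\sinh(\frac{\pi}{150}\sqrt{\alpha_k^+})}+\Big[\alpha_k^+-\tfrac{k^2}{5}\Big]\frac{\sin(y\sqrt{\alpha_k^-})}{\sin(\frac{\pi}{150}\sqrt{\alpha_k^-})}\quad(k=1,2),$$ $$\omega_k^2=\pi\int_0^{\pi/150}v_k^2\,dy\quad(k=1,\dots,14),\qquad\bar\omega_k^2=\pi\int_0^{\pi/150}\theta_k^2\,dy\quad(k=1,2),$$ $$a_k=\frac{\pi}{\omega_k^2}\int_{3\pi/500}^{\pi/150}v_k^2\,dy,\qquad b_k=\frac{3\pi}{4\omega_k^4}\int_{3\pi/500}^{\pi/150}v_k^4\,dy,\qquad\bar a_l=\frac{\pi}{\bar\omega_l^2}\int_{3\pi/500}^{\pi/150}\theta_l^2\,dy,$$ $$d_{l,k}=\frac{9\pi}{4\omega_l^2\bar\omega_l^2}\int_{3\pi/500}^{\pi/150}v_l^2\theta_l^2\,dy\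 \text{ if }l=k,\qquad d_{l,k}=\frac{3\pi}{2\omega_k^2\bar\omega_l^2}\int_{3\pi/500}^{\pi/150}v_k^2\theta_l^2\,dy\ \text{ if }l\ne k.$$ Longitudinal mode. For $(\phi_0^k,\phi_1^k)\in\mathbb{R}^2\setminus\{(0,0)\}$, the $k$-th longitudinal mode $\overline\varphi_k$ at energy $$E(\phi_0^k,\phi_1^k)=\frac{(\phi_1^k)^2}{2}+(\gamma\mu_{k,1}+a_k)\frac{(\phi_0^k)^2}{2}+b_k\frac{(\phi_0^k)^4}{4}$$ is the unique (periodic) solution of $$\varphi''(t)+(\gamma\mu_{k,1}+a_k)\varphi(t)+b_k\varphi(t)^3=0,\qquad\varphi(0)=\phi_0^k,\ \varphi'(0)=\phi_1^k.$$ (Initial data with the same energy give the same solution up to a time translation.) $\|\cdot\|_\infty$ is the sup-norm. Torsional stability. The mode $\overline\varphi_k$ at energy $E(\phi_0^k,\phi_1^k)$ is called stable with respect to the $l$-th torsional mode if the trivial solution $\xi\equiv0$ of the Hill equation $$\xi''(t)+A_{l,k}(t)\xi(t)=0,\qquad A_{l,k}(t)=\gamma\nu_{l,2}+\bar a_l+d_{l,k}\overline\varphi_k(t)^2,$$ is stable in the Lyapunov sense, i.e. solutions with small $|\xi(0)|$, $|\xi'(0)|$ remain small for all $t\ge0$. *)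

(* Defs.v *)
From Stdlib Require Import Reals ClassicalEpsilon.
From Coquelicot Require Import Coquelicot.
Open Scope R_scope.

Definition sigma : R := 1 / 5.
Definition ell : R := PI / 150.

(** Eigenvalues. *)

Definition mu_char (k : nat) (lam : R) : Prop :=
  let K := INR k ^ 2 in
  let s := sqrt lam in
  (1 - sigma) ^ 2 * INR k ^ 4 < lam < INR k ^ 4 /\
  sqrt (K - s) * (s + (1 - sigma) * K) ^ 2 * tanh (ell * sqrt (K - s)) =
  sqrt (K + s) * (s - (1 - sigma) * K) ^ 2 * tanh (ell * sqrt (K + s)).

(* [mu_char k] has exactly one solution for [1 <= k]. *)
Definition mu (k : nat) : R := epsilon (inhabits 0) (mu_char k).

(* [tan] is total, so its poles have to be excluded explicitly. *)
Definition nu_char (k : nat) (lam : R) : Prop :=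
  let K := INR k ^ 2 in
  let s := sqrt lam in
  INR k ^ 4 < lam /\
  cos (ell * sqrt (s - K)) <> 0 /\
  sqrt (s - K) * (s + (1 - sigma) * K) ^ 2 * tanh (ell * sqrt (s + K)) =
  sqrt (s + K) * (s - (1 - sigma) * K) ^ 2 * tan (ell * sqrt (s - K)).

Definition nu (k : nat) : R :=
  epsilon (inhabits 0)
    (fun lam => nu_char k lam /\ forall lam', nu_char k lam' -> lam <= lam').

(** Eigenfunctions. *)

Definition beta_p (k : nat) : R := INR k ^ 2 + sqrt (mu k).
Definition beta_m (k : nat) : R := INR k ^ 2 - sqrt (mu k).
Definition alpha_p (k : nat) : R := sqrt (nu k) + INR k ^ 2.
Definition alpha_m (k : nat) : R := sqrt (nu k) - INR k ^ 2.

Definition v (k : nat) (y : R) : R :=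
  (INR k ^ 2 / 5 - beta_m k) *
    (cosh (y * sqrt (beta_p k)) / cosh (PI / 150 * sqrt (beta_p k))) +
  (beta_p k - INR k ^ 2 / 5) *
    (cosh (y * sqrt (beta_m k)) / cosh (PI / 150 * sqrt (beta_m k))).

Definition theta (k : nat) (y : R) : R :=
  (INR k ^ 2 / 5 + alpha_m k) *
    (sinh (y * sqrt (alpha_p k)) / sinh (PI / 150 * sqrt (alpha_p k))) +
  (alpha_p k - INR k ^ 2 / 5) *
    (sin (y * sqrt (alpha_m k)) / sin (PI / 150 * sqrt (alpha_m k))).

(* The squares of the normalization constants. *)
Definition omega2 (k : nat) : R := PI * RInt (fun y => v k y ^ 2) 0 (PI / 150).
Definition omegabar2 (k : nat) : R :=
  PI * RInt (fun y => theta k y ^ 2) 0 (PI / 150).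

Definition a (k : nat) : R :=
  PI / omega2 k * RInt (fun y => v k y ^ 2) (3 * PI / 500) (PI / 150).

Definition b (k : nat) : R :=
  3 * PI / (4 * omega2 k ^ 2) *
  RInt (fun y => v k y ^ 4) (3 * PI / 500) (PI / 150).

Definition abar (l : nat) : R :=
  PI / omegabar2 l * RInt (fun y => theta l y ^ 2) (3 * PI / 500) (PI / 150).

Definition d (l k : nat) : R :=
  if Nat.eqb l k then
    9 * PI / (4 * omega2 l * omegabar2 l) *
    RInt (fun y => v l y ^ 2 * theta l y ^ 2) (3 * PI / 500) (PI / 150)
  else
    3 * PI / (2 * omega2 k * omegabar2 l) *
    RInt (fun y => v k y ^ 2 * theta l y ^ 2) (3 * PI / 500) (PI / 150).

(** Differential equations. *)

(* [x] is twice differentiable on the real line with [x'' = F t x]. *)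
Definition solves2 (F : R -> R -> R) (x : R -> R) : Prop :=
  forall t, ex_derive x t /\ is_derive (Derive x) t (F t (x t)).

Definition energy (gamma : R) (k : nat) (phi0 phi1 : R) : R :=
  phi1 ^ 2 / 2 + (gamma * mu k + a k) * (phi0 ^ 2 / 2) + b k * (phi0 ^ 4 / 4).

Definition longitudinal_mode (gamma : R) (k : nat) (phi0 phi1 : R)
    (phi : R -> R) : Prop :=
  solves2 (fun _ x => - ((gamma * mu k + a k) * x + b k * x ^ 3)) phi /\
  phi 0 = phi0 /\ Derive phi 0 = phi1.

Definition sup_norm (f : R -> R) : Rbar :=
  Lub_Rbar (fun r => exists t, r = Rabs (f t)).

Definition hill_coeff (gamma : R) (l k : nat) (phi : R -> R) (t : R) : R :=
  gamma * nu l + abar l + d l k * phi t ^ 2.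

(* Lyapunov stability of the trivial solution of [xi'' + A t * xi = 0], in the
   phase space [(xi, xi')]. *)
Definition hill_stable (A : R -> R) : Prop :=
  forall eps, 0 < eps -> exists delta, 0 < delta /\
  forall xi, solves2 (fun t x => - (A t * x)) xi ->
    Rabs (xi 0) < delta -> Rabs (Derive xi 0) < delta ->
    forall t, 0 <= t -> Rabs (xi t) < eps /\ Rabs (Derive xi t) < eps.

Definition torsionally_stable (gamma : R) (l k : nat) (phi : R -> R) : Prop :=
  hill_stable (hill_coeff gamma l k phi).

(* Main.v *)
(** The energy identity writes the mode as [phi = rho cos s] with
    [s' = g(s) = sqrt (A + b rho^2 (1 + cos^2 s) / 2)], so that in the time [s]
    the Hill equation becomes a planar system with explicit coefficients of
    period [PI].  Over one period the phase of its solutions advances by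
    [int sqrt Q / g], [Q] being the Hill coefficient, up to an error
    [int |Q'| / (4 Q)]; to first order in [rho^2] the hypothesis on [d] says
    exactly that this lies below [(m + 1) PI], and it exceeds [m PI] for small
    [rho].  Hence no solution is parallel to its translate by a period, the
    monodromy is elliptic, and all solutions are bounded in terms of their
    initial data. *)

Require Import Defs.
From Stdlib Require Import Reals Lra Lia Classical ClassicalEpsilon.
From Coquelicot Require Import Coquelicot.
Open Scope R_scope.

(** * Calculus and phase functions *)

(** At the exact ratio [n^2], with [n = m + 1], the unperturbed phase advance is [n PI] and the
    monodromy is plus or minus the identity. This is the edge of a stability zone, so continuity in
    the amplitude decides nothing and the first-order term must push the phase inwards. Put
    [u = d rho^2 / (n^2 A)] and [v = b rho^2 / A]. The growth of [Q] adds [n PI u / 4], since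
    [cos^2] has mean 1/2. The growth of [g] removes [3/8 n PI v], since [1 + cos^2] has mean 3/2.
    The variation of [Q] costs at most [u / 2]. Asking that the sum be negative and clearing
    denominators gives [2 (2 + n PI) d < 3 PI n^3 b]. Below, [m PI] there is almost a whole [PI] of
    room, so a crude bound suffices. The monodromy never appears as a matrix; it is seen only
    through a solution and its translate by a period. *)

Lemma is_derive_eq (f : R -> R) (t l l' : R) :
  is_derive f t l -> l = l' -> is_derive f t l'.
Proof. now intros H <-. Qed.

Lemma is_derive_continuous (f : R -> R) (t l : R) :
  is_derive f t l -> continuous f t.
Proof. intros H; apply (ex_derive_continuous f t); now exists l. Qed.

Lemma is_derive_const_mult (f : R -> R) (c t l : R) :
  is_derive f t l -> is_derive (fun s => c * f s) t (c * l).
Proof. exact (is_derive_scal f t c l). Qed.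

Lemma is_derive_prod (f g : R -> R) (t df dg : R) :
  is_derive f t df -> is_derive g t dg ->
  is_derive (fun s => f s * g s) t (df * g t + f t * dg).
Proof.
  intros Hf Hg; apply (is_derive_mult f g t df dg Hf Hg Rmult_comm).
Qed.

Lemma is_derive_sum (f g : R -> R) (t df dg : R) :
  is_derive f t df -> is_derive g t dg ->
  is_derive (fun s => f s + g s) t (df + dg).
Proof. exact (is_derive_plus f g t df dg). Qed.

Lemma is_derive_diff (f g : R -> R) (t df dg : R) :
  is_derive f t df -> is_derive g t dg ->
  is_derive (fun s => f s - g s) t (df - dg).
Proof. exact (is_derive_minus f g t df dg). Qed.

Lemma is_derive_compose (f g : R -> R) (t df dg : R) :
  is_derive f (g t) df -> is_derive g t dg ->
  is_derive (fun s => f (g s)) t (df * dg).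
Proof.
  intros Hf Hg. rewrite Rmult_comm. exact (is_derive_comp f g t df dg Hf Hg).
Qed.

Lemma is_derive_shift (f : R -> R) (c t l : R) :
  is_derive f (t + c) l -> is_derive (fun s => f (s + c)) t l.
Proof.
  intros H; apply is_derive_eq with (l * 1); [|ring].
  apply is_derive_compose; [exact H|]. auto_derive; auto; ring.
Qed.

Lemma derive_nonneg_le (f df : R -> R) (s t : R) :
  s <= t ->
  (forall u, s <= u <= t -> is_derive f u (df u)) ->
  (forall u, s <= u <= t -> 0 <= df u) ->
  f s <= f t.
Proof.
  intros Hst Hd Hp.
  destruct (MVT_gen f s t df) as [c [Hc E]];
    rewrite ?Rmin_left, ?Rmax_right in * by easy.
  - intros u Hu; apply Hd; lra.
  - intros u Hu; apply continuity_pt_filterlim.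
    apply (is_derive_continuous _ _ _ (Hd u Hu)).
  - specialize (Hp c Hc). nra.
Qed.

Lemma derive_pos_lt (f df : R -> R) (s t : R) :
  s < t -> (forall u, is_derive f u (df u)) -> (forall u, 0 < df u) -> f s < f t.
Proof.
  intros Hst Hd Hp.
  destruct (MVT_gen f s t df) as [c [Hc E]].
  - intros u _; apply Hd.
  - intros u _; apply continuity_pt_filterlim.
    apply (is_derive_continuous _ _ _ (Hd u)).
  - specialize (Hp c). nra.
Qed.

Lemma derive_zero_const (f : R -> R) (s t : R) :
  (forall u, is_derive f u 0) -> f s = f t.
Proof.
  intros Hd. destruct (MVT_gen f s t (fun _ => 0)) as [c [_ E]].
  - intros u _; apply Hd.
  - intros u _; apply continuity_pt_filterlim.
    apply (is_derive_continuous _ _ _ (Hd u)).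
  - lra.
Qed.

Lemma antiderivative_ex (f : R -> R) (c s : R) :
  (forall t, continuous f t) ->
  exists F, (forall t, is_derive F t (f t)) /\ F s = c.
Proof.
  intros Hf. exists (fun t => c + RInt f s t); split.
  - intros t; apply is_derive_eq with (0 + f t); [|ring].
    apply is_derive_sum; [exact (is_derive_const c t)|].
    apply (is_derive_RInt f (RInt f s) s); [|apply Hf].
    apply filter_forall; intros u.
    apply (RInt_correct f), (ex_RInt_continuous f); auto.
  - rewrite RInt_point; unfold zero; simpl; ring.
Qed.

Lemma cos_sin_ex (x y : R) : x ^ 2 + y ^ 2 = 1 -> exists t, x = cos t /\ y = sin t.
Proof.
  intros H. assert (Hx : -1 <= x <= 1) by nra.
  assert (Hs : sqrt (1 - x²) = Rabs y).
  { rewrite <- sqrt_Rsqr_abs. f_equal. unfold Rsqr; lra. }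
  destruct (Rle_dec 0 y) as [Hy|Hy].
  - exists (acos x). rewrite cos_acos, sin_acos, Hs, Rabs_pos_eq by lra; auto.
  - exists (- acos x).
    rewrite cos_neg, sin_neg, cos_acos, sin_acos, Hs, Rabs_left by lra; lra.
Qed.

(* The inner product of [(c, s)] with the candidate [(cos th, sin th)] is
   constant, equal to 1 at the base point, and both are unit vectors. *)
Lemma angle_lift (c s om : R -> R) :
  (forall t, continuous om t) ->
  (forall t, is_derive c t (- (om t * s t))) ->
  (forall t, is_derive s t (om t * c t)) ->
  (forall t, c t ^ 2 + s t ^ 2 = 1) ->
  exists th, (forall t, is_derive th t (om t)) /\
             (forall t, c t = cos (th t) /\ s t = sin (th t)).
Proof.
  intros Hom Hc Hs Hn.
  destruct (cos_sin_ex _ _ (Hn 0)) as [t0 [E1 E2]].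
  destruct (antiderivative_ex om t0 0 Hom) as [th [Hth E0]].
  exists th; split; [exact Hth|].
  assert (Hcos : forall t, is_derive (fun u => cos (th u)) t (- sin (th t) * om t)).
  { intros t; apply is_derive_compose; [apply is_derive_cos|apply Hth]. }
  assert (Hsin : forall t, is_derive (fun u => sin (th u)) t (cos (th t) * om t)).
  { intros t; apply is_derive_compose; [apply is_derive_sin|apply Hth]. }
  assert (K : forall t, c t * cos (th t) + s t * sin (th t) = 1).
  { intros t.
    rewrite (derive_zero_const (fun t => c t * cos (th t) + s t * sin (th t)) t 0).
    - rewrite E0, E1, E2. pose proof (sin2_cos2 t0) as H; unfold Rsqr in H; lra.
    - intros u. eapply is_derive_eq.
      + apply is_derive_sum; apply is_derive_prod; auto.
      + simpl; ring. }
  intros t. specialize (K t). specialize (Hn t).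
  pose proof (sin2_cos2 (th t)) as H; unfold Rsqr in H.
  destruct (Rplus_sqr_eq_0 (c t - cos (th t)) (s t - sin (th t)));
    [unfold Rsqr; nra | lra].
Qed.

(** * Periodic planar systems *)

(** With [p = / g] and [q = Q / g] this is the Hill equation in the time [s], where [ds = g dt]; [y]
    is then the derivative of [x] in the original time. *)
Definition solves_system (p q x y : R -> R) : Prop :=
  forall s, is_derive x s (p s * y s) /\ is_derive y s (- (q s * x s)).

Definition wedge (x1 y1 x2 y2 : R -> R) (s : R) : R := x1 s * y2 s - x2 s * y1 s.

Section PlanarSystem.

Variables p q : R -> R.
Let sol := solves_system p q.

(** The coefficient matrix has zero trace, so the Wronskian is conserved. *)
Lemma wedge_const (x1 y1 x2 y2 : R -> R) (s t : R) :
  sol x1 y1 -> sol x2 y2 -> wedge x1 y1 x2 y2 s = wedge x1 y1 x2 y2 t.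
Proof.
  intros H1 H2. apply derive_zero_const. intros u.
  destruct (H1 u) as [? ?], (H2 u) as [? ?]. unfold wedge. eapply is_derive_eq.
  - apply is_derive_diff; apply is_derive_prod; eauto.
  - simpl; ring.
Qed.

Lemma solution_lincomb (x1 y1 x2 y2 : R -> R) (c1 c2 : R) :
  sol x1 y1 -> sol x2 y2 ->
  sol (fun s => c1 * x1 s + c2 * x2 s) (fun s => c1 * y1 s + c2 * y2 s).
Proof.
  intros H1 H2 s. destruct (H1 s) as [? ?], (H2 s) as [? ?].
  split; (eapply is_derive_eq;
    [apply is_derive_sum; apply is_derive_const_mult; eauto | simpl; ring]).
Qed.

(** Gronwall: [N = x^2 + y^2] satisfies [|N'| <= K N], so [exp (- K s) N] is nonincreasing, which
    settles [s >= s0], and [exp (K s) N] is nondecreasing, which settles [s < s0]. *)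
Lemma solution_vanishing (K : R) (x y : R -> R) (s0 : R) :
  (forall s, Rabs (p s - q s) <= K) -> sol x y ->
  x s0 = 0 -> y s0 = 0 -> forall s, x s = 0 /\ y s = 0.
Proof.
  intros HK Hsol Hx Hy.
  assert (HN : forall s, x s ^ 2 + y s ^ 2 <= 0 -> x s = 0 /\ y s = 0).
  { intros s H; apply Rplus_sqr_eq_0; unfold Rsqr; nra. }
  assert (Hd : forall c s, is_derive
    (fun s => exp (c * s) * (x s * x s + y s * y s)) s
    (exp (c * s) * (c * (x s ^ 2 + y s ^ 2) + 2 * (p s - q s) * (x s * y s)))).
  { intros c s. destruct (Hsol s) as [? ?]. eapply is_derive_eq.
    - apply is_derive_prod.
      + instantiate (1 := exp (c * s) * c).
        apply (is_derive_compose exp (fun s => c * s)).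
        * apply is_derive_exp.
        * auto_derive; auto; ring.
      + apply is_derive_sum; apply is_derive_prod; eauto.
    - simpl; ring. }
  assert (Hb : forall s, Rabs (2 * (p s - q s) * (x s * y s)) <= K * (x s ^ 2 + y s ^ 2)).
  { intros s. specialize (HK s). rewrite !Rabs_mult, (Rabs_pos_eq 2) by lra.
    pose proof (Rabs_pos (p s - q s)).
    rewrite <- (pow2_abs (x s)), <- (pow2_abs (y s)).
    set (X := Rabs (x s)); set (Y := Rabs (y s)).
    assert (0 <= X /\ 0 <= Y) by (split; apply Rabs_pos).
    assert (2 * (X * Y) <= X ^ 2 + Y ^ 2) by (pose proof (pow2_ge_0 (X - Y)); nra).
    assert (0 <= X * Y) by (apply Rmult_le_pos; easy).
    nra. }
  intros s. apply HN.
  destruct (Rle_dec s0 s) as [Hs|Hs].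
  - assert (L := derive_nonneg_le
      (fun s => - (exp (- K * s) * (x s * x s + y s * y s))) _ s0 s Hs
      (fun u _ => is_derive_opp _ _ _ (Hd (- K) u))).
    cbv beta in L. rewrite Hx, Hy in L.
    pose proof (exp_pos (- K * s)).
    assert (0 <= - (exp (- K * s) * (x s * x s + y s * y s))); [|nra].
    eapply Rle_trans; [|apply L]; [lra|].
    intros u _. unfold opp; simpl. pose proof (exp_pos (- K * u)).
    specialize (Hb u). apply Rabs_le_between in Hb. nra.
  - assert (L := derive_nonneg_le _ _ s s0 ltac:(lra) (fun u _ => Hd K u)).
    cbv beta in L. rewrite Hx, Hy in L.
    pose proof (exp_pos (K * s)).
    assert (exp (K * s) * (x s * x s + y s * y s) <= 0); [|nra].
    eapply Rle_trans; [apply L|]; [|lra].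
    intros u _. pose proof (exp_pos (K * u)).
    specialize (Hb u). apply Rabs_le_between in Hb. nra.
Qed.

Variable P : R.
Hypothesis P_pos : 0 < P.
Hypothesis p_periodic : forall s, p (s + P) = p s.
Hypothesis q_periodic : forall s, q (s + P) = q s.

Lemma solution_translate (x y : R -> R) :
  sol x y -> sol (fun s => x (s + P)) (fun s => y (s + P)).
Proof.
  intros H s. rewrite <- (p_periodic s), <- (q_periodic s).
  destruct (H (s + P)); split; apply is_derive_shift; auto.
Qed.

Lemma periodic_continuous_bounded (f : R -> R) (s0 : R) :
  (forall s, continuous f s) -> (forall s, f (s + P) = f s) ->
  exists M, forall s, s0 <= s -> f s <= M.
Proof.
  intros Hc Hp.
  destruct (continuity_ab_maj f s0 (s0 + P)) as [m [Hm _]]; [lra| |].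
  { intros c _. apply continuity_pt_filterlim, Hc. }
  exists (f m). intros s Hs.
  assert (Hn : forall n s, f (s + INR n * P) = f s).
  { induction n as [|n IH]; intros u.
    - f_equal; simpl; ring.
    - rewrite <- (IH u), <- (Hp (u + INR n * P)). f_equal. rewrite S_INR; ring. }
  destruct (nfloor_ex ((s - s0) / P)) as [n [H1 H2]].
  { apply Rdiv_le_0_compat; lra. }
  replace (f s) with (f (s - INR n * P))
    by (rewrite <- (Hn n (s - INR n * P)); f_equal; ring).
  apply Hm. apply (Rmult_le_compat_r P) in H1; [|lra].
  apply (Rmult_lt_compat_r P) in H2; [|lra].
  unfold Rdiv in H1, H2. rewrite Rmult_assoc, Rinv_l in H1, H2 by lra. lra.
Qed.

(* If no nonzero solution is parallel to its translate, the trace [beta] of the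
   monodromy satisfies [|beta| < 2], since otherwise there is a real Floquet
   multiplier.  Then [z(s + 2P) = beta z(s + P) - z(s)] leaves invariant the
   positive definite form [|z(s)|^2 + |z(s + P)|^2 - beta z(s).z(s + P)]. *)
Lemma elliptic_solution_bounded (x y : R -> R) (s0 : R) :
  (forall x y, sol x y -> x 0 <> 0 \/ y 0 <> 0 -> x 0 * y P - x P * y 0 <> 0) ->
  sol x y -> x 0 <> 0 \/ y 0 <> 0 ->
  exists M, forall s, s0 <= s -> x s ^ 2 + y s ^ 2 <= M.
Proof.
  intros Hell Hz Hnz.
  assert (HzP := solution_translate _ _ Hz).
  assert (HzPP := solution_translate _ _ HzP). cbv beta in HzPP.
  set (W := x 0 * y P - x P * y 0). assert (HW : W <> 0) by now apply Hell.
  assert (W1 : forall s, x s * y (s + P) - x (s + P) * y s = W).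
  { intros s. assert (E := wedge_const _ _ _ _ s 0 Hz HzP).
    unfold wedge in E. rewrite Rplus_0_l in E. exact E. }
  set (beta := (x 0 * y (0 + P + P) - x (0 + P + P) * y 0) / W).
  assert (W2 : forall s, x s * y (s + P + P) - x (s + P + P) * y s = beta * W).
  { intros s. assert (E := wedge_const _ _ _ _ s 0 Hz HzPP).
    unfold wedge in E. rewrite E. unfold beta. field; auto. }
  (* Cayley-Hamilton for a monodromy of determinant one: by Cramer's rule the second translate is
     expanded in [z(s)] and [z(s + P)]. The coefficient of [z(s)] is -1 because the Wronskian [W] is
     the same at [s] and [s + P]. *)
  assert (Rec : forall s, x (s + P + P) = beta * x (s + P) - x s /\
                          y (s + P + P) = beta * y (s + P) - y s).
  { intros s. assert (A1 := W1 s). assert (A2 := W2 s). assert (A3 := W1 (s + P)).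
    split; apply (Rmult_eq_reg_r W); auto.
    - replace (x (s + P + P) * W)
        with (x (s + P + P) * (x s * y (s + P) - x (s + P) * y s)) by now rewrite A1.
      transitivity (x (s + P) * (beta * W) - x s * W); [|ring].
      rewrite <- A2, <- A3. ring.
    - replace (y (s + P + P) * W)
        with (y (s + P + P) * (x s * y (s + P) - x (s + P) * y s)) by now rewrite A1.
      transitivity (y (s + P) * (beta * W) - y s * W); [|ring].
      rewrite <- A2, <- A3. ring. }
  assert (Hbeta : Rabs beta < 2).
  { apply Rnot_le_lt; intros Hge.
    assert (Hdisc : 0 <= beta ^ 2 - 4).
    { rewrite <- (pow2_abs beta). nra. }
    (* A real root of the characteristic polynomial. Since [beta - la = / la], the solution
       [z(s + P) - la z(s)] is multiplied by [/ la] under translation; it is nonzero, as otherwise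
       [W = 0]. *)
    set (la := (beta + sqrt (beta ^ 2 - 4)) / 2).
    assert (Hla : la ^ 2 - beta * la + 1 = 0).
    { unfold la. pose proof (pow2_sqrt _ Hdisc). nra. }
    assert (Hla0 : la <> 0) by (intros E; rewrite E in Hla; lra).
    assert (Hu := solution_lincomb _ _ _ _ 1 (- la) HzP Hz).
    destruct (Rec 0) as [R1 R2].
    rewrite Rplus_0_l in R1, R2.
    apply (Hell _ _ Hu); cbv beta; rewrite ?Rplus_0_l.
    - apply NNPP; intros E. apply not_or_and in E; destruct E as [E1 E2].
      apply NNPP in E1; apply NNPP in E2. apply HW. unfold W.
      replace (y P) with (la * y 0) by lra. replace (x P) with (la * x 0) by lra.
      ring.
    - rewrite R1, R2. apply (Rmult_eq_reg_l la); auto.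
      transitivity ((la ^ 2 - beta * la + 1) * (la * (x 0 * y P - x P * y 0)));
        [ring | rewrite Hla; ring]. }
  set (Q := fun s => (x s * x s + y s * y s)
     + (x (s + P) * x (s + P) + y (s + P) * y (s + P))
     - beta * (x s * x (s + P) + y s * y (s + P))).
  destruct (periodic_continuous_bounded Q s0) as [M HM].
  - intros s. unfold Q.
    destruct (Hz s) as [? ?], (Hz (s + P)) as [? ?].
    apply (ex_derive_continuous (V := R_NormedModule)).
    auto_derive; repeat split; eexists; eassumption.
  - intros s. unfold Q. destruct (Rec s) as [-> ->]. ring.
  - exists (M / (1 - Rabs beta / 2)). intros s Hs.
    specialize (HM s Hs). unfold Q in HM.
    assert (Hr : 0 < 1 - Rabs beta / 2) by lra.
    apply (Rmult_le_reg_r (1 - Rabs beta / 2)); [exact Hr|].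
    unfold Rdiv at 2. rewrite Rmult_assoc, Rinv_l, Rmult_1_r by lra.
    eapply Rle_trans; [|exact HM].
    set (X := x (s + P)); set (Y := y (s + P)).
    assert (Hb := Rle_abs beta). assert (Hb' := Rle_abs (- beta)).
    rewrite Rabs_Ropp in Hb'.
    assert (T : forall u w, beta * (u * w) <= Rabs beta / 2 * (u ^ 2 + w ^ 2)).
    { intros u w.
      assert (0 <= (Rabs beta + beta) * (u - w) ^ 2)
        by (apply Rmult_le_pos; [lra | apply pow2_ge_0]).
      assert (0 <= (Rabs beta - beta) * (u + w) ^ 2)
        by (apply Rmult_le_pos; [lra | apply pow2_ge_0]).
      lra. }
    assert (T1 := T (x s) X). assert (T2 := T (y s) Y).
    assert (0 <= (1 - Rabs beta / 2) * (X ^ 2 + Y ^ 2))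
      by (apply Rmult_le_pos; [lra | nra]).
    lra.
Qed.

(** A single nonzero solution and its translate form a bounded basis. The coordinates of any other
    solution in it are Wronskians divided by [W], hence constant and controlled by the values at
    [s0]. *)
Lemma elliptic_system_bounded (s0 : R) :
  (forall x y s, sol x y -> x 0 = 0 -> y 0 = 0 -> x s = 0 /\ y s = 0) ->
  (forall x y, sol x y -> x 0 <> 0 \/ y 0 <> 0 -> x 0 * y P - x P * y 0 <> 0) ->
  exists C, 0 <= C /\ forall x y, sol x y -> forall s, s0 <= s ->
    Rabs (x s) <= C * (Rabs (x s0) + Rabs (y s0)) /\
    Rabs (y s) <= C * (Rabs (x s0) + Rabs (y s0)).
Proof.
  intros Huniq Hell.
  destruct (classic (exists x y, sol x y /\ (x 0 <> 0 \/ y 0 <> 0)))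
    as [[x [y [Hz Hnz]]]|Hno].
  2: { exists 0; split; [lra|]. intros x y Hsol s _.
    destruct (Huniq x y s Hsol) as [-> ->].
    1, 2: apply NNPP; intros E; apply Hno; exists x, y; auto.
    rewrite Rabs_R0; lra. }
  assert (HzP := solution_translate _ _ Hz).
  set (W := x 0 * y P - x P * y 0). assert (HW : W <> 0) by now apply Hell.
  assert (W1 : forall s, x s * y (s + P) - x (s + P) * y s = W).
  { intros s. assert (E := wedge_const _ _ _ _ s 0 Hz HzP).
    unfold wedge in E. rewrite Rplus_0_l in E. exact E. }
  destruct (elliptic_solution_bounded x y s0 Hell Hz Hnz) as [M HM].
  assert (HMp : 0 <= M) by (specialize (HM s0 ltac:(lra)); nra).
  set (B := sqrt M).
  assert (HB : forall s, s0 <= s -> Rabs (x s) <= B /\ Rabs (y s) <= B).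
  { intros s Hs. specialize (HM s Hs).
    split; rewrite <- sqrt_Rsqr_abs; apply sqrt_le_1_alt; unfold Rsqr; nra. }
  assert (HB0 : 0 <= B) by apply sqrt_pos.
  exists (2 * B * B / Rabs W). split.
  { apply Rdiv_le_0_compat; [nra|now apply Rabs_pos_lt]. }
  intros x1 y1 H1 s Hs.
  set (c1 := x1 s0 * y (s0 + P) - x (s0 + P) * y1 s0).
  set (c2 := x s0 * y1 s0 - x1 s0 * y s0).
  assert (E1 : x1 s * y (s + P) - x (s + P) * y1 s = c1)
    by exact (wedge_const _ _ _ _ s s0 H1 HzP).
  assert (E2 : x s * y1 s - x1 s * y s = c2)
    by exact (wedge_const _ _ _ _ s s0 Hz H1).
  assert (Hprod : forall u w S, Rabs u <= B -> Rabs w <= S -> Rabs (u * w) <= B * S).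
  { intros u w S H2 H3. rewrite Rabs_mult.
    apply Rmult_le_compat; auto using Rabs_pos. }
  destruct (HB s0) as [B1 B2]; [lra|].
  destruct (HB (s0 + P)) as [B3 B4]; [lra|].
  destruct (HB s) as [B5 B6]; [lra|].
  destruct (HB (s + P)) as [B7 B8]; [lra|].
  set (S := Rabs (x1 s0) + Rabs (y1 s0)).
  assert (C1 : Rabs c1 <= B * S).
  { unfold c1, Rminus. eapply Rle_trans; [apply Rabs_triang|].
    rewrite Rabs_Ropp, !Rabs_mult. unfold S.
    pose proof (Rabs_pos (x1 s0)). pose proof (Rabs_pos (y1 s0)). nra. }
  assert (C2 : Rabs c2 <= B * S).
  { unfold c2, Rminus. eapply Rle_trans; [apply Rabs_triang|].
    rewrite Rabs_Ropp, !Rabs_mult. unfold S.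
    pose proof (Rabs_pos (x1 s0)). pose proof (Rabs_pos (y1 s0)). nra. }
  assert (HWp : 0 < Rabs W) by now apply Rabs_pos_lt.
  assert (Fin : forall u w V, Rabs u <= B -> Rabs w <= B -> V * W = u * c1 + w * c2 ->
    Rabs V <= 2 * B * B / Rabs W * S).
  { intros u w V Hu Hw E. apply (Rmult_le_reg_r (Rabs W)); auto.
    rewrite <- Rabs_mult, E.
    replace (2 * B * B / Rabs W * S * Rabs W) with (B * (B * S) + B * (B * S))
      by (field; lra).
    eapply Rle_trans; [apply Rabs_triang|].
    apply Rplus_le_compat; apply Hprod; auto. }
  assert (A1 := W1 s).
  split; [apply (Fin (x s) (x (s + P)))|apply (Fin (y s) (y (s + P)))]; auto;
    rewrite <- A1, <- E1, <- E2; ring.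
Qed.

End PlanarSystem.

(** * Rotation of the Hill equation over a period *)

(* [psi] is the phase of [(sqrt Q x, - y)]. *)
Lemma hill_phase_ex (g Q dQ x y : R -> R) :
  (forall s, 0 < g s) -> (forall s, continuous g s) ->
  (forall s, 0 < Q s) -> (forall s, is_derive Q s (dQ s)) ->
  (forall s, continuous dQ s) ->
  solves_system (fun s => / g s) (fun s => Q s / g s) x y ->
  (forall s, x s <> 0 \/ y s <> 0) ->
  exists psi dpsi,
    (forall s, is_derive psi s (dpsi s)) /\
    (forall s, Rabs (dpsi s - sqrt (Q s) / g s) <= Rabs (dQ s) / (4 * Q s)) /\
    (forall s, exists r, 0 < r /\
       sqrt (Q s) * x s = r * cos (psi s) /\ y s = - (r * sin (psi s))).
Proof.
  intros Hg Hgc HQ HdQ HdQc Hsol Hnz.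
  set (N := fun s => Q s * (x s * x s) + y s * y s).
  assert (HN : forall s, 0 < N s).
  { intros s. unfold N. specialize (HQ s).
    destruct (Hnz s) as [H|H]; apply Rsqr_pos_lt in H; unfold Rsqr in H; nra. }
  set (w := fun s => sqrt (Q s)). set (r := fun s => sqrt (N s)).
  assert (Hw : forall s, 0 < w s) by (intros; apply sqrt_lt_R0; auto).
  assert (Hr : forall s, 0 < r s) by (intros; apply sqrt_lt_R0; auto).
  assert (Ew : forall s, w s * w s = Q s) by (intros; apply sqrt_sqrt, Rlt_le; auto).
  assert (Er : forall s, r s * r s = w s * w s * (x s * x s) + y s * y s).
  { intros s. rewrite Ew. apply sqrt_sqrt, Rlt_le, HN. }
  assert (Dw : forall s, is_derive w s (dQ s / (2 * w s))).
  { intros s. apply (is_derive_sqrt Q); auto. }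
  assert (Dr : forall s, is_derive r s (dQ s * (x s * x s) / (2 * r s))).
  { intros s. apply (is_derive_sqrt N); auto. destruct (Hsol s) as [? ?].
    eapply is_derive_eq.
    - apply is_derive_sum; apply is_derive_prod;
        [| apply is_derive_prod | |]; eauto.
    - simpl. field. apply Rgt_not_eq, Hg. }
  (* For [X = w x] and [Y = - y] this is [(X Y' - Y X') / r^2]. The weight [w = sqrt Q] makes the
     main rotation [w / g] independent of the solution; what remains comes from [w'] alone and is
     bounded using [2 |X Y| <= r^2]. *)
  set (om := fun s => w s / g s + dQ s * x s * y s / (2 * w s * (r s * r s))).
  destruct (angle_lift (fun s => w s * x s / r s) (fun s => - (y s / r s)) om)
    as [psi [Dpsi Epsi]].
  - intros s.
    assert (Hcp : forall f, continuous f s -> continuity_pt f s)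
      by (intros f Hf; apply continuity_pt_filterlim, Hf).
    assert (continuity_pt w s) by apply Hcp, (is_derive_continuous _ _ _ (Dw s)).
    assert (continuity_pt r s) by apply Hcp, (is_derive_continuous _ _ _ (Dr s)).
    assert (continuity_pt x s)
      by apply Hcp, (is_derive_continuous _ _ _ (proj1 (Hsol s))).
    assert (continuity_pt y s)
      by apply Hcp, (is_derive_continuous _ _ _ (proj2 (Hsol s))).
    assert (Cg := Hcp _ (Hgc s)). assert (CdQ := Hcp _ (HdQc s)).
    specialize (Hg s). specialize (Hw s). specialize (Hr s).
    apply continuity_pt_filterlim.
    assert (0 < w s * (r s * r s)) by (repeat apply Rmult_lt_0_compat; auto).
    unfold om.
    apply continuity_pt_plus; apply continuity_pt_div; auto; try lra;
    repeat apply continuity_pt_mult; auto.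
    apply continuity_pt_const; now intros ? ?.
  - intros s. destruct (Hsol s) as [? ?].
    specialize (Hg s). specialize (Hw s). specialize (Hr s).
    eapply is_derive_eq.
    + apply (is_derive_div (fun s => w s * x s) r); [|apply Dr|lra].
      apply is_derive_prod; [apply Dw|eauto].
    + unfold om. simpl.
      transitivity ((w s * y s / g s * (r s * r s) +
        dQ s * x s / (2 * w s) * (r s * r s - w s * w s * (x s * x s))) / (r s * r s * r s)).
      { field; repeat split; lra. }
      assert (w s * w s * (x s * x s) + y s * y s <> 0) by (rewrite <- Er; nra).
      rewrite Er. field; repeat split; auto; lra.
  - intros s. destruct (Hsol s) as [? ?].
    specialize (Hg s). specialize (Hw s). specialize (Hr s).
    eapply is_derive_eq.
    + apply (is_derive_opp (fun s => y s / r s)), (is_derive_div y r); eauto; lra.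
    + unfold om, opp. simpl. rewrite <- Ew. field; repeat split; lra.
  - intros s. specialize (Hr s).
    transitivity ((w s * w s * (x s * x s) + y s * y s) / (r s * r s)).
    { field; repeat split; lra. }
    rewrite <- Er. field; repeat split; lra.
  - exists psi, om. split; [exact Dpsi|split].
    + intros s. unfold om. specialize (Er s).
      specialize (Hg s). specialize (HQ s). specialize (Hw s). specialize (Hr s).
      fold (w s). rewrite <- Ew.
      replace (_ - _) with (dQ s * (w s * x s * y s / (2 * (w s * w s) * (r s * r s))))
        by (field; repeat split; lra).
      rewrite Rabs_mult. unfold Rdiv at 2.
      apply Rmult_le_compat_l; [apply Rabs_pos|].
      assert (0 < w s * w s * (r s * r s)) by (repeat apply Rmult_lt_0_compat; auto).
      apply Rabs_le_between.
      pose proof (pow2_ge_0 (w s * x s - y s)).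
      pose proof (pow2_ge_0 (w s * x s + y s)).
      split; apply (Rmult_le_reg_r (4 * (w s * w s * (r s * r s)))); try lra.
      * replace (- / (4 * (w s * w s)) * (4 * (w s * w s * (r s * r s))))
          with (- (r s * r s)) by (field; repeat split; lra).
        replace (_ / _ * _) with (2 * (w s * x s * y s)) by (field; repeat split; lra).
        lra.
      * replace (/ (4 * (w s * w s)) * (4 * (w s * w s * (r s * r s))))
          with (r s * r s) by (field; repeat split; lra).
        replace (_ / _ * _) with (2 * (w s * x s * y s)) by (field; repeat split; lra).
        lra.
    + intros s. exists (r s). destruct (Epsi s) as [E1 E2].
      specialize (Hr s). rewrite <- E1, <- E2. fold (w s).
      repeat split; auto; field; repeat split; lra.
Qed.

Lemma sin_neq_0_between (m : nat) (x : R) :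
  INR m * PI < x < (INR m + 1) * PI -> sin x <> 0.
Proof.
  intros Hx H. apply sin_eq_0_0 in H. destruct H as [k ->].
  pose proof PI_RGT_0. rewrite INR_IZR_INZ in Hx.
  assert (Z.of_nat m < k)%Z by (apply lt_IZR; nra).
  assert (k < Z.of_nat m + 1)%Z by (apply lt_IZR; rewrite plus_IZR; nra).
  lia.
Qed.

(* The oscillator in the angle variable [s] of the mode [rho cos s], with
   [v = b rho^2 / A] and [u = d rho^2 / (n^2 A)], where [A] and [n^2 A] are the
   linear coefficients of the mode and of the Hill equation. *)
Definition speed (A v s : R) : R := sqrt (A * (1 + v / 2 * (1 + cos s ^ 2))).
Definition hill_angle (n A u s : R) : R := n ^ 2 * A * (1 + u * cos s ^ 2).

Section Ellipticity.

Variables (n A u v : R).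
Hypothesis n_ge_1 : 1 <= n.
Hypothesis A_pos : 0 < A.
Hypothesis u_nonneg : 0 <= u.
Hypothesis v_nonneg : 0 <= v.

Let g := speed A v.
Let Q := hill_angle n A u.

Lemma cos_sq_bounds (s : R) : 0 <= cos s ^ 2 <= 1.
Proof. pose proof (COS_bound s). split; nra. Qed.

Lemma speed_arg_pos (s : R) : 0 < A * (1 + v / 2 * (1 + cos s ^ 2)).
Proof. pose proof (cos_sq_bounds s). apply Rmult_lt_0_compat; nra. Qed.

Lemma speed_pos (s : R) : 0 < speed A v s.
Proof. apply sqrt_lt_R0, speed_arg_pos. Qed.

Lemma speed_continuous (s : R) : continuous (speed A v) s.
Proof.
  apply (ex_derive_continuous (V := R_NormedModule)). unfold speed.
  auto_derive. repeat split. apply (speed_arg_pos s).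
Qed.

Lemma hill_angle_ge (s : R) : n ^ 2 * A <= hill_angle n A u s.
Proof.
  pose proof (cos_sq_bounds s). unfold hill_angle.
  assert (0 <= n ^ 2 * A) by nra.
  assert (0 <= u * cos s ^ 2) by (apply Rmult_le_pos; lra).
  nra.
Qed.

Lemma hill_angle_pos (s : R) : 0 < hill_angle n A u s.
Proof.
  apply Rlt_le_trans with (n ^ 2 * A); [|apply hill_angle_ge].
  apply Rmult_lt_0_compat; nra.
Qed.

Lemma speed_le (s : R) : speed A v s <= sqrt A * (1 + v).
Proof.
  unfold speed. rewrite <- (sqrt_Rsqr (1 + v)), <- sqrt_mult_alt by lra.
  apply sqrt_le_1_alt. apply Rmult_le_compat_l; [lra|].
  pose proof (cos_sq_bounds s). unfold Rsqr. nra.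
Qed.

(** From [sqrt Q >= n sqrt A], [g <= sqrt A (1 + v)] and [(1 - v) (1 + v) <= 1]; for [v >= 1] the
    left side is not positive. *)
Lemma frequency_ge (s : R) : n * (1 - v) <= sqrt (Q s) / g s.
Proof.
  pose proof (speed_pos s) as Hg. fold (g s) in Hg.
  apply (Rmult_le_reg_r (g s)); [exact Hg|].
  replace (sqrt (Q s) / g s * g s) with (sqrt (Q s)) by (field; lra).
  apply Rle_trans with (n * sqrt A).
  2: { rewrite <- (sqrt_Rsqr n), <- sqrt_mult_alt by (unfold Rsqr; nra).
    apply sqrt_le_1_alt. pose proof (hill_angle_ge s). fold (Q s) in *.
    unfold Rsqr. lra. }
  rewrite Rmult_assoc. apply Rmult_le_compat_l; [lra|].
  pose proof (sqrt_lt_R0 A A_pos). pose proof (speed_le s) as H1. fold (g s) in H1.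
  destruct (Rle_dec 1 v); nra.
Qed.

(* [sqrt z <= (1 + z) / 2] at [z = Q / (n g)^2], then [1 / (1 + t) <= 1 - t + t^2]. *)
Lemma frequency_le (s : R) :
  sqrt (Q s) / g s <=
  n * (1 + (v ^ 2 - v / 2) / 2) + n / 2 * (u - v / 2) * cos s ^ 2.
Proof.
  pose proof (speed_pos s) as Hg. fold (g s) in Hg.
  assert (Eg : g s * g s = A * (1 + v / 2 * (1 + cos s ^ 2))).
  { apply sqrt_sqrt, Rlt_le, speed_arg_pos. }
  assert (Ew : sqrt (Q s) * sqrt (Q s) = Q s).
  { apply sqrt_sqrt, Rlt_le, hill_angle_pos. }
  set (w := sqrt (Q s)) in *. set (h := g s) in *.
  pose proof (cos_sq_bounds s) as Hc.
  assert (HQ : Q s = n ^ 2 * A * (1 + u * cos s ^ 2)) by reflexivity.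
  set (c := cos s ^ 2) in *.
  assert (H1 : 1 + u * c <= (1 + v / 2 * (1 + c)) * (1 + u * c - v / 2 * (1 + c) + v ^ 2)).
  { assert (0 <= v / 2 * (1 + c) <= v) by nra.
    set (t := v / 2 * (1 + c)) in *. assert (0 <= u * c) by (apply Rmult_le_pos; lra).
    assert (0 <= t * (u * c)) by (apply Rmult_le_pos; lra).
    assert (0 <= t * v ^ 2) by (apply Rmult_le_pos; nra).
    nra. }
  assert (Hn : 0 < n) by lra.
  assert (Hz : w / h / n * (w / h / n) <= 1 + u * c - v / 2 * (1 + c) + v ^ 2).
  { apply (Rmult_le_reg_r (h * h * n ^ 2)); [repeat apply Rmult_lt_0_compat; lra|].
    replace (w / h / n * (w / h / n) * (h * h * n ^ 2)) with (w * w) by (field; repeat split; lra).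
    rewrite Ew, HQ, Eg.
    assert (0 <= n ^ 2 * A) by nra. nra. }
  set (z := w / h / n) in *. replace (w / h) with (n * z) by (unfold z; field; lra).
  pose proof (pow2_ge_0 (z - 1)).
  assert (z <= 1 + (u * c - v / 2 * (1 + c) + v ^ 2) / 2) by lra.
  apply (Rmult_le_compat_l n) in H0; lra.
Qed.

Let dQ := fun s => - (n ^ 2 * A * u * (2 * (sin s * cos s))).

Lemma hill_angle_derive (s : R) : is_derive (hill_angle n A u) s (dQ s).
Proof. unfold hill_angle, dQ. auto_derive; auto. ring. Qed.

Lemma hill_angle_variation (s : R) :
  Rabs (dQ s) / (4 * Q s) <= u / 2 * Rabs (sin s * cos s).
Proof.
  pose proof (hill_angle_pos s) as H. pose proof (hill_angle_ge s) as H'.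
  fold (Q s) in H, H'. unfold dQ.
  replace (n ^ 2 * A * u * (2 * (sin s * cos s)))
    with (2 * (n ^ 2 * A * u) * (sin s * cos s)) by ring.
  assert (0 <= n ^ 2 * A * u) by (repeat apply Rmult_le_pos; nra).
  rewrite Rabs_Ropp, Rabs_mult, (Rabs_pos_eq (2 * _)) by lra.
  set (X := Rabs (sin s * cos s)).
  assert (0 <= u * X) by (apply Rmult_le_pos; [lra|apply Rabs_pos]).
  apply (Rmult_le_reg_r (4 * Q s)); [lra|].
  replace (_ / _ * _) with (2 * (n ^ 2 * A * u) * X) by (field; lra).
  nra.
Qed.

Lemma hill_phase_advance (psi dpsi : R -> R) :
  (forall s, is_derive psi s (dpsi s)) ->
  (forall s, Rabs (dpsi s - sqrt (Q s) / g s) <= Rabs (dQ s) / (4 * Q s)) ->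
  n * PI * (1 - v) - u / 2 <= psi PI - psi 0 <=
  n * PI + (n * PI / 4 * u + u / 2 + n * PI / 2 * v ^ 2 - 3 / 8 * n * PI * v).
Proof.
  intros Dpsi Hpsi. pose proof PI_RGT_0 as HPI.
  assert (Hb : forall s, n * (1 - v) - u / 2 * Rabs (sin s * cos s) <= dpsi s <=
    n * (1 + (v ^ 2 - v / 2) / 2) + n / 2 * (u - v / 2) * cos s ^ 2
      + u / 2 * Rabs (sin s * cos s)).
  { intros s. specialize (Hpsi s). apply Rabs_le_between in Hpsi.
    pose proof (hill_angle_variation s). pose proof (frequency_le s).
    pose proof (frequency_ge s). lra. }
  set (k0 := n * (1 + (v ^ 2 - v / 2) / 2)) in *.
  set (k1 := n / 2 * (u - v / 2)) in *.
  (* Comparison functions replace integrals. The period is split at [PI / 2], where [sin s * cos s]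
     changes sign, and [e = u / 4] or [- (u / 4)] makes the derivative of [e * sin s ^ 2] equal to
     [u / 2 * Rabs (sin s * cos s)] on each half. *)
  assert (Dlow : forall e s, is_derive (fun s => psi s - n * (1 - v) * s + e * (sin s ^ 2)) s
    (dpsi s - n * (1 - v) + e * (2 * (sin s * cos s)))).
  { intros e s. apply is_derive_sum; [apply is_derive_diff|]; auto;
      auto_derive; auto; ring. }
  assert (Dup : forall e s, is_derive
    (fun s => k0 * s + k1 * ((s + sin s * cos s) / 2) + e * (sin s ^ 2) - psi s) s
    (k0 + k1 * cos s ^ 2 + e * (2 * (sin s * cos s)) - dpsi s)).
  { intros e s. apply is_derive_diff; auto. auto_derive; auto.
    pose proof (sin2_cos2 s) as H; unfold Rsqr in H.
    replace (cos s ^ 2) with ((1 + cos s * cos s - sin s * sin s) / 2) by lra.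
    field. }
  assert (S1 : forall s, 0 <= s <= PI / 2 -> Rabs (sin s * cos s) = sin s * cos s).
  { intros s Hs. apply Rabs_pos_eq, Rmult_le_pos;
      [apply sin_ge_0|apply cos_ge_0]; lra. }
  assert (S2 : forall s, PI / 2 <= s <= PI -> Rabs (sin s * cos s) = - (sin s * cos s)).
  { intros s Hs. rewrite Rabs_mult, (Rabs_pos_eq (sin s)) by (apply sin_ge_0; lra).
    rewrite Rabs_left1 by (apply cos_le_0; lra). ring. }
  assert (L1 := derive_nonneg_le _ _ 0 (PI / 2) ltac:(lra) (fun s _ => Dlow (u / 4) s)).
  assert (L2 := derive_nonneg_le _ _ (PI / 2) PI ltac:(lra) (fun s _ => Dlow (- (u / 4)) s)).
  assert (U1 := derive_nonneg_le _ _ 0 (PI / 2) ltac:(lra) (fun s _ => Dup (u / 4) s)).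
  assert (U2 := derive_nonneg_le _ _ (PI / 2) PI ltac:(lra) (fun s _ => Dup (- (u / 4)) s)).
  cbv beta in L1, L2, U1, U2.
  rewrite sin_0, sin_PI2, ?cos_0, ?cos_PI2 in *. rewrite sin_PI, ?cos_PI in *.
  assert (Q1 : psi (PI / 2) - psi 0 >= n * (1 - v) * (PI / 2) - u / 4).
  { enough (psi 0 - n * (1 - v) * 0 + u / 4 * 0 ^ 2 <=
      psi (PI / 2) - n * (1 - v) * (PI / 2) + u / 4 * 1 ^ 2) by lra.
    apply L1. intros s Hs. specialize (Hb s). rewrite (S1 s Hs) in Hb. lra. }
  assert (Q2 : psi PI - psi (PI / 2) >= n * (1 - v) * (PI / 2) - u / 4).
  { enough (psi (PI / 2) - n * (1 - v) * (PI / 2) + - (u / 4) * 1 ^ 2 <=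
      psi PI - n * (1 - v) * PI + - (u / 4) * 0 ^ 2) by lra.
    apply L2. intros s Hs. specialize (Hb s). rewrite (S2 s Hs) in Hb. lra. }
  split; [lra|].
  assert (Q3 := U1 ltac:(intros s Hs; specialize (Hb s); rewrite (S1 s Hs) in Hb; lra)).
  assert (Q4 := U2 ltac:(intros s Hs; specialize (Hb s); rewrite (S2 s Hs) in Hb; lra)).
  unfold k0, k1 in Q3, Q4. lra.
Qed.

(** The two smallness conditions place the phase advance strictly above [m PI] and strictly below
    [(m + 1) PI]. *)
Lemma hill_angle_system_bounded (m : nat) (s0 : R) :
  n = INR m + 1 ->
  n * PI * v + u / 2 < PI ->
  n * PI / 4 * u + u / 2 + n * PI / 2 * v ^ 2 < 3 / 8 * n * PI * v ->
  exists C, 0 <= C /\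
    forall x y, solves_system (fun s => / g s) (fun s => Q s / g s) x y ->
    forall s, s0 <= s ->
      Rabs (x s) <= C * (Rabs (x s0) + Rabs (y s0)) /\
      Rabs (y s) <= C * (Rabs (x s0) + Rabs (y s0)).
Proof.
  intros Hm Hlow Hup.
  assert (Hcos : forall s, cos (s + PI) ^ 2 = cos s ^ 2) by (intros; rewrite neg_cos; ring).
  assert (Pg : forall s, g (s + PI) = g s)
    by (intros; unfold g, speed; now rewrite Hcos).
  assert (PQ : forall s, Q (s + PI) = Q s)
    by (intros; unfold Q, hill_angle; now rewrite Hcos).
  assert (Hg : forall s, 0 < g s) by apply speed_pos.
  assert (HQ : forall s, 0 < Q s) by apply hill_angle_pos.
  assert (Huniq : forall x y s s1,
    solves_system (fun s => / g s) (fun s => Q s / g s) x y ->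
    x s1 = 0 -> y s1 = 0 -> x s = 0 /\ y s = 0).
  { intros x y s s1 Hsol Hx Hy.
    apply (solution_vanishing (fun s => / g s) (fun s => Q s / g s)
      ((1 + n ^ 2 * A * (1 + u)) / sqrt A) x y s1); auto.
    intros t. specialize (Hg t). specialize (HQ t).
    replace (/ g t - Q t / g t) with ((1 - Q t) / g t) by (field; repeat split; lra).
    pose proof (sqrt_lt_R0 A A_pos) as HA.
    unfold Rdiv. rewrite Rabs_mult, (Rabs_pos_eq (/ g t))
      by (apply Rlt_le, Rinv_0_lt_compat; lra).
    pose proof (cos_sq_bounds t) as Hc.
    apply Rmult_le_compat; [apply Rabs_pos| | |].
    - apply Rlt_le, Rinv_0_lt_compat; lra.
    - assert (Q t <= n ^ 2 * A * (1 + u)).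
      { unfold Q, hill_angle. apply Rmult_le_compat_l; nra. }
      apply Rabs_le_between; lra.
    - apply Rinv_le_contravar; auto. apply sqrt_le_1_alt.
      assert (0 <= v / 2 * (1 + cos t ^ 2)) by (apply Rmult_le_pos; lra). nra. }
  apply (elliptic_system_bounded (fun s => / g s) (fun s => Q s / g s) PI).
  - exact PI_RGT_0.
  - intros s. now rewrite Pg.
  - intros s. now rewrite Pg, PQ.
  - intros x y s Hsol. apply Huniq; auto.
  - intros x y Hsol H0.
    destruct (hill_phase_ex g Q dQ x y) as [psi [dpsi [D1 [D2 D3]]]]; auto.
    + apply speed_continuous.
    + apply hill_angle_derive.
    + intros s. apply (ex_derive_continuous (V := R_NormedModule)).
      unfold dQ. auto_derive; auto.
    + intros s. apply not_and_or. intros [E1 E2].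
      destruct (Huniq x y 0 s Hsol E1 E2). tauto.
    + destruct (hill_phase_advance psi dpsi D1 D2) as [Hl Hu].
      destruct (D3 0) as [r0 [Hr0 [E1 E2]]].
      destruct (D3 PI) as [r1 [Hr1 [E3 E4]]].
      rewrite <- (Rplus_0_l PI), PQ in E3 at 1.
      assert (Hw := sqrt_lt_R0 _ (HQ 0)). set (w := sqrt (Q 0)) in *.
      (* As [Q PI = Q 0], the weight [w] is the same at both ends, and the Wronskian of a solution
         with its translate is [- r0 r1 / w] times the sine of the phase advance. *)
      intros E. apply (sin_neq_0_between m (psi PI - psi 0)).
      { assert (n * PI = INR m * PI + PI) by (rewrite Hm; ring). lra. }
      rewrite sin_minus. apply (Rmult_eq_reg_l (r0 * r1)); [|nra].
      transitivity (- (r0 * cos (psi 0) * - (r1 * sin (psi PI))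
         - r1 * cos (psi PI) * - (r0 * sin (psi 0)))); [ring|].
      rewrite <- E1, <- E2, <- E3, <- E4.
      transitivity (- w * (x 0 * y PI - x PI * y 0)); [ring|]. rewrite E. ring.
Qed.

End Ellipticity.

(** * Signs of the coefficients *)

Lemma cosh_pos (x : R) : 0 < cosh x.
Proof. unfold cosh. pose proof (exp_pos x). pose proof (exp_pos (- x)). lra. Qed.

Lemma tanh_pos (x : R) : 0 < x -> 0 < tanh x.
Proof.
  intros Hx. apply Rdiv_lt_0_compat; [|apply cosh_pos].
  unfold sinh. pose proof (exp_increasing (- x) x ltac:(lra)). lra.
Qed.

Lemma tanh_continuous (x : R) : continuous tanh x.
Proof.
  apply (ex_derive_continuous (V := R_NormedModule)).
  assert (H := cosh_pos x). unfold tanh, sinh, cosh in *. auto_derive. lra.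
Qed.

(* As a function of [s = sqrt lam], the difference of the two sides changes sign
   between [(1 - sigma) k^2], where the right side vanishes, and [k^2], where
   the left side does. *)
Lemma mu_char_ex (k : nat) : (1 <= k)%nat -> exists lam, mu_char k lam.
Proof.
  intros Hk. set (K := INR k ^ 2).
  assert (HK : 0 < K) by (apply pow_lt, lt_0_INR; lia).
  (* Both sides of the equation at once: [e = -1] gives the left one and [e = 1] the right one. *)
  set (h := fun e s => sqrt (K + e * s) * (s - e * (1 - Defs.sigma) * K) ^ 2
                       * tanh (ell * sqrt (K + e * s))).
  assert (Hell : 0 < ell) by (unfold ell; pose proof PI_RGT_0; lra).
  assert (Hc : forall e s, continuous (h e) s).
  { intros e s.
    assert (C1 : continuous (fun s => sqrt (K + e * s)) s).
    { apply (continuous_comp (fun s => K + e * s) sqrt); [|apply continuous_sqrt].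
      apply (ex_derive_continuous (V := R_NormedModule)). auto_derive; auto. }
    apply (continuous_mult (K := R_AbsRing)); [apply (continuous_mult (K := R_AbsRing))|].
    - exact C1.
    - apply (ex_derive_continuous (V := R_NormedModule)). auto_derive; auto.
    - apply (continuous_comp (fun s => ell * sqrt (K + e * s)) tanh);
        [|apply tanh_continuous].
      apply (continuous_scal_r (K := R_AbsRing) (V := R_NormedModule) ell), C1. }
  assert (H0 : forall e s, K + e * s = 0 -> h e s = 0).
  { intros e s E. unfold h. rewrite E, sqrt_0. ring. }
  assert (H1 : forall e s, s = e * (1 - Defs.sigma) * K -> h e s = 0).
  { intros e s E. unfold h. rewrite <- E. ring. }
  assert (H2 : forall e s, 0 < K + e * s -> s <> e * (1 - Defs.sigma) * K -> 0 < h e s).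
  { intros e s Hp Hn. assert (Hq := sqrt_lt_R0 _ Hp).
    unfold h. apply Rmult_lt_0_compat; [apply Rmult_lt_0_compat; auto|].
    - apply pow2_gt_0. lra.
    - apply tanh_pos, Rmult_lt_0_compat; auto. }
  unfold Defs.sigma in *.
  destruct (IVT_cor (fun s => h (-1) s - h 1 s) (4 / 5 * K) K) as [s [Hs E]].
  - intros s. apply continuity_pt_minus; apply continuity_pt_filterlim, Hc.
  - lra.
  - rewrite (H1 1 (4 / 5 * K)), (H0 (-1) K) by lra.
    assert (0 < h (-1) (4 / 5 * K)) by (apply H2; lra).
    assert (0 < h 1 K) by (apply H2; lra). nra.
  - assert (Hs1 : s <> 4 / 5 * K).
    { intros ->. rewrite (H1 1) in E by lra.
      assert (0 < h (-1) (4 / 5 * K)) by (apply H2; lra). lra. }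
    assert (Hs2 : s <> K).
    { intros ->. rewrite (H0 (-1)) in E by lra.
      assert (0 < h 1 K) by (apply H2; lra). lra. }
    assert (Ek : INR k ^ 4 = K * K) by (unfold K; ring).
    exists (s * s). unfold mu_char. rewrite Ek. fold K.
    rewrite sqrt_square by lra. unfold Defs.sigma. split; [split; nra|].
    apply Rminus_diag_uniq in E. unfold h in E.
    replace (K + -1 * s) with (K - s) in E by ring.
    replace (K + 1 * s) with (K + s) in E by ring.
    replace (s - -1 * (1 - 1 / 5) * K) with (s + (1 - 1 / 5) * K) in E by ring.
    replace (s - 1 * (1 - 1 / 5) * K) with (s - (1 - 1 / 5) * K) in E by ring.
    exact E.
Qed.

Lemma sqrt_mu_bounds (k : nat) :
  (1 <= k)%nat -> 4 / 5 * INR k ^ 2 < sqrt (mu k) < INR k ^ 2.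
Proof.
  intros Hk.
  assert (H : mu_char k (mu k)) by exact (epsilon_spec _ _ (mu_char_ex k Hk)).
  destruct H as [[H1 H2] _]. unfold Defs.sigma in H1.
  assert (HK : 0 < INR k ^ 2) by (apply pow_lt, lt_0_INR; lia).
  rewrite <- (sqrt_square (INR k ^ 2)) at 2 by lra.
  rewrite <- (sqrt_square (4 / 5 * INR k ^ 2)) by lra.
  split; apply sqrt_lt_1_alt; nra.
Qed.

Lemma mu_pos (k : nat) : (1 <= k)%nat -> 0 < mu k.
Proof.
  intros Hk. apply Rnot_le_lt. intros H. apply sqrt_neg_0 in H.
  pose proof (sqrt_mu_bounds k Hk).
  assert (0 < INR k ^ 2) by (apply pow_lt, lt_0_INR; lia). lra.
Qed.

(** The first coefficient equals [sqrt (mu k) - 4 / 5 * INR k ^ 2], so its sign is exactly the lower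
    bound imposed on [mu k]. *)
Lemma v_pos (k : nat) (y : R) : (1 <= k)%nat -> 0 < v k y.
Proof.
  intros Hk. pose proof (sqrt_mu_bounds k Hk).
  unfold v, beta_m, beta_p.
  apply Rplus_lt_0_compat; apply Rmult_lt_0_compat; try lra;
    apply Rdiv_lt_0_compat; apply cosh_pos.
Qed.

Lemma v_continuous (k : nat) (y : R) : continuous (v k) y.
Proof.
  apply (ex_derive_continuous (V := R_NormedModule)). unfold v, Rdiv.
  set (c1 := / cosh _). set (c2 := / cosh (_ * sqrt (beta_m k))).
  unfold cosh. auto_derive; auto.
Qed.

(* The constant denominators may vanish, and then the junk value [/ 0] is still
   a constant. *)
Lemma theta_continuous (l : nat) (y : R) : continuous (theta l) y.
Proof.
  apply (ex_derive_continuous (V := R_NormedModule)). unfold theta, Rdiv.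
  set (c1 := / sinh _). set (c2 := / sin (PI * _ * _)).
  unfold sinh. auto_derive; auto.
Qed.

Lemma pow_continuous (f : R -> R) (n : nat) (y : R) :
  continuous f y -> continuous (fun y => f y ^ n) y.
Proof.
  intros Hf. apply (continuous_comp f (fun z => z ^ n)); auto.
  apply (ex_derive_continuous (V := R_NormedModule)). auto_derive; auto.
Qed.

Lemma omega2_pos (k : nat) : (1 <= k)%nat -> 0 < omega2 k.
Proof.
  intros Hk. pose proof PI_RGT_0. apply Rmult_lt_0_compat; auto.
  apply RInt_gt_0; [lra| |].
  - intros y _. apply pow_lt, v_pos, Hk.
  - intros y _. apply pow_continuous, v_continuous.
Qed.

Lemma RInt_continuous_nonneg (f : R -> R) (s t : R) :
  s <= t -> (forall y, continuous f y) -> (forall y, 0 <= f y) -> 0 <= RInt f s t.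
Proof.
  intros Hst Hc Hp. apply RInt_ge_0; auto.
  apply (ex_RInt_continuous f); auto.
Qed.

Lemma a_nonneg (k : nat) : (1 <= k)%nat -> 0 <= a k.
Proof.
  intros Hk. pose proof PI_RGT_0. apply Rmult_le_pos.
  - apply Rlt_le, Rdiv_lt_0_compat; auto. now apply omega2_pos.
  - apply RInt_continuous_nonneg; [lra| |].
    + intros y. apply pow_continuous, v_continuous.
    + intros y. apply pow2_ge_0.
Qed.

Lemma b_pos (k : nat) : (1 <= k)%nat -> 0 < b k.
Proof.
  intros Hk. pose proof PI_RGT_0. apply Rmult_lt_0_compat.
  - apply Rdiv_lt_0_compat; [lra|].
    apply Rmult_lt_0_compat; [lra|]. now apply pow_lt, omega2_pos.
  - apply RInt_gt_0; [lra| |].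
    + intros y _. apply pow_lt, v_pos, Hk.
    + intros y _. apply pow_continuous, v_continuous.
Qed.

(** Because [/ 0 = 0], this also serves denominators containing [omegabar2], known only to be
    nonnegative. *)
Lemma Rdiv_nonneg (x y : R) : 0 <= x -> 0 <= y -> 0 <= x / y.
Proof.
  intros Hx [Hy|<-].
  - now apply Rdiv_le_0_compat.
  - unfold Rdiv. rewrite Rinv_0. lra.
Qed.

(* Holds even if [nu l] is a junk value. *)
Lemma d_nonneg (l k : nat) : (1 <= k)%nat -> 0 <= d l k.
Proof.
  intros Hk. pose proof PI_RGT_0. pose proof (omega2_pos k Hk) as Ho.
  assert (Hb : 0 <= omegabar2 l).
  { apply Rmult_le_pos; [lra|]. apply RInt_continuous_nonneg; [lra| |].
    - intros y. apply pow_continuous, theta_continuous.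
    - intros y. apply pow2_ge_0. }
  assert (HI : 0 <= RInt (fun y => v k y ^ 2 * theta l y ^ 2) (3 * PI / 500) (PI / 150)).
  { apply RInt_continuous_nonneg; [lra| |].
    - intros y. apply (continuous_mult (K := R_AbsRing)); apply pow_continuous;
        [apply v_continuous|apply theta_continuous].
    - intros y. apply Rmult_le_pos; apply pow2_ge_0. }
  unfold d. destruct (Nat.eqb l k) eqn:E; [apply Nat.eqb_eq in E; subst l|];
    (apply Rmult_le_pos; [apply Rdiv_nonneg; [lra|]|exact HI]);
    (apply Rmult_le_pos; [lra|exact Hb]).
Qed.

(** * The longitudinal mode *)

(* The squared amplitude of a solution of [x'' + A x + B x^3 = 0] of energy [E],
   i.e. the nonnegative root [r] of [A r / 2 + B r^2 / 4 = E]. *)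
Definition amplitude2 (A B E : R) : R := (- A + sqrt (A ^ 2 + 4 * B * E)) / B.

Section Amplitude.

Variables A B : R.
Hypothesis A_pos : 0 < A.
Hypothesis B_pos : 0 < B.

Lemma amplitude2_0 : amplitude2 A B 0 = 0.
Proof.
  unfold amplitude2. replace (A ^ 2 + 4 * B * 0) with (A * A) by ring.
  rewrite sqrt_square by lra. field. lra.
Qed.

Lemma amplitude2_lt (x y : R) :
  0 <= x -> x < y -> amplitude2 A B x < amplitude2 A B y.
Proof.
  intros Hx Hxy. apply Rmult_lt_compat_r; [now apply Rinv_0_lt_compat|].
  apply Rplus_lt_compat_l, sqrt_lt_1_alt. nra.
Qed.

Lemma amplitude2_nonneg (x : R) : 0 <= x -> 0 <= amplitude2 A B x.
Proof.
  intros [Hx|<-]; rewrite <- amplitude2_0 at 1; [|lra].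
  apply Rlt_le, amplitude2_lt; lra.
Qed.

Lemma amplitude2_energy (E : R) :
  0 <= E -> A * amplitude2 A B E / 2 + B * amplitude2 A B E ^ 2 / 4 = E.
Proof.
  intros HE. unfold amplitude2.
  assert (H : 0 <= A ^ 2 + 4 * B * E) by nra.
  apply pow2_sqrt in H. set (S := sqrt _) in *.
  replace E with ((S ^ 2 - A ^ 2) / (4 * B)) by (rewrite H; field; lra).
  field. lra.
Qed.

Lemma duffing_energy_const (phi : R -> R) (t : R) :
  solves2 (fun _ x => - (A * x + B * x ^ 3)) phi ->
  Derive phi t ^ 2 / 2 + A * (phi t ^ 2 / 2) + B * (phi t ^ 4 / 4) =
  Derive phi 0 ^ 2 / 2 + A * (phi 0 ^ 2 / 2) + B * (phi 0 ^ 4 / 4).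
Proof.
  intros Hphi.
  set (e := fun q p => q ^ 2 / 2 + A * (p ^ 2 / 2) + B * (p ^ 4 / 4)).
  apply (derive_zero_const (fun t => e (Derive phi t) (phi t))). intros u.
  destruct (Hphi u) as [H1 H2]. apply Derive_correct in H1. cbv beta in H2.
  set (p := Derive phi) in *. unfold e. auto_derive.
  - repeat split; eexists; eassumption.
  - rewrite (is_derive_unique (fun x : R => phi x) _ _ H1),
      (is_derive_unique (fun x : R => p x) _ _ H2). field.
Qed.

(* [phi = rho cos s] and [phi' = - rho s' sin s], with [s'] determined by the
   conservation of energy. *)
Lemma duffing_angle (phi : R -> R) (E : R) :
  0 < E ->
  solves2 (fun _ x => - (A * x + B * x ^ 3)) phi ->
  Derive phi 0 ^ 2 / 2 + A * (phi 0 ^ 2 / 2) + B * (phi 0 ^ 4 / 4) = E ->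
  exists s, (forall t, is_derive s t (speed A (B * amplitude2 A B E / A) (s t))) /\
            (forall t, phi t = sqrt (amplitude2 A B E) * cos (s t)).
Proof.
  intros HE Hphi H0.
  assert (He := amplitude2_energy E (Rlt_le _ _ HE)).
  assert (Hr : 0 < amplitude2 A B E).
  { rewrite <- amplitude2_0 at 1. apply amplitude2_lt; lra. }
  set (r := amplitude2 A B E) in *.
  set (rho := sqrt r). assert (Hrho : 0 < rho) by now apply sqrt_lt_R0.
  assert (Er : rho * rho = r) by (apply sqrt_sqrt; lra).
  set (q := Derive phi).
  assert (Hp : forall t, is_derive phi t (q t)).
  { intros t. apply Derive_correct, Hphi. }
  assert (Hq : forall t, is_derive q t (- (A * phi t + B * phi t ^ 3))).
  { intros t. apply Hphi. }
  (* The energy written at amplitude [rho] minus the energy at time [t] has the factor [r - phi^2].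
     The cofactor is bounded away from 0, so its root [h] can be divided by even at turning points;
     it becomes the angular speed. *)
  assert (Hcons : forall t,
    q t * q t = (r - phi t * phi t) * (A + B / 2 * (r + phi t * phi t))).
  { intros t. assert (H := duffing_energy_const phi t Hphi). fold q in H, H0.
    nra. }
  assert (Ha : forall t, 0 < A + B / 2 * (r + phi t * phi t)) by (intros; nra).
  set (h := fun t => sqrt (A + B / 2 * (r + phi t * phi t))).
  assert (Hh : forall t, 0 < h t) by (intros; apply sqrt_lt_R0; auto).
  assert (Eh : forall t, h t * h t = A + B / 2 * (r + phi t * phi t)).
  { intros t. apply sqrt_sqrt, Rlt_le, Ha. }
  assert (Dh : forall t, is_derive h t (B * phi t * q t / (2 * h t))).
  { intros t. apply (is_derive_sqrt (fun t => A + B / 2 * (r + phi t * phi t))); auto.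
    auto_derive; [repeat split; eexists; apply Hp|].
    rewrite (is_derive_unique (fun x : R => phi x) _ _ (Hp t)). field. }
  destruct (angle_lift (fun t => phi t / rho) (fun t => - (q t / (rho * h t))) h)
    as [s [Ds Es]].
  - intros t. exact (is_derive_continuous _ _ _ (Dh t)).
  - intros t. specialize (Hh t).
    apply is_derive_eq with (q t * / rho); [|field; lra].
    apply (is_derive_eq _ _ (/ rho * q t)); [|ring].
    apply (is_derive_ext (fun t => / rho * phi t)); [intros; apply Rmult_comm|].
    apply is_derive_const_mult, Hp.
  - intros t. specialize (Hh t). specialize (Eh t). specialize (Hcons t).
    assert (0 < rho * h t) by now apply Rmult_lt_0_compat.
    eapply is_derive_eq.
    + apply (is_derive_opp (fun t => q t / (rho * h t))).
      apply (is_derive_div q (fun t => rho * h t)); [apply Hq| |lra].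
      apply is_derive_const_mult, Dh.
    + unfold opp. simpl.
      transitivity ((h t * h t * phi t * (A + B * (phi t * phi t)) +
        B / 2 * phi t * (q t * q t)) / (rho * (h t * h t * h t))).
      { field. lra. }
      rewrite Hcons, <- Eh.
      transitivity (phi t * (A + B / 2 * (r + phi t * phi t)) / (rho * h t)).
      { field. lra. }
      rewrite <- Eh. field. lra.
  - intros t. specialize (Hh t). specialize (Eh t). specialize (Hcons t).
    transitivity ((phi t * phi t * (h t * h t) + q t * q t) / (rho * rho * (h t * h t))).
    { field. lra. }
    rewrite Hcons, <- Eh, Er. field. lra.
  - exists s. split.
    + intros t. apply is_derive_eq with (h t); [apply Ds|].
      unfold h, speed. f_equal.
      rewrite <- (proj1 (Es t)). rewrite <- Er. field. lra.
    + intros t. rewrite <- (proj1 (Es t)). field. lra.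
Qed.

End Amplitude.

(** * Change of time and transfer of stability *)

(** [T (s t) - t] has zero derivative. Surjectivity of [s] then needs no limits: [T] is injective
    and [T (s (T x)) = T x]. *)
Lemma time_inverse_ex (g s : R -> R) :
  (forall x, 0 < g x) -> (forall x, continuous g x) ->
  (forall t, is_derive s t (g (s t))) ->
  exists T, (forall x, is_derive T x (/ g x)) /\
            (forall t, T (s t) = t) /\ (forall x, s (T x) = x).
Proof.
  intros Hg Hc Hs.
  destruct (antiderivative_ex (fun x => / g x) 0 (s 0)) as [T [HT E]].
  { intros x. apply (continuous_comp g Rinv); auto.
    apply continuous_Rinv. apply Rgt_not_eq, Hg. }
  assert (K : forall t, T (s t) = t).
  { intros t. enough (T (s t) - t = 0) by lra.
    rewrite (derive_zero_const (fun t => T (s t) - t) t 0), E; [ring|].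
    intros u. eapply is_derive_eq.
    - apply is_derive_diff; [|apply is_derive_id].
      apply is_derive_compose; [apply HT|apply Hs].
    - unfold one; simpl. specialize (Hg (s u)). field. lra. }
  exists T. split; [exact HT|split; [exact K|]].
  assert (Tlt : forall x y, x < y -> T x < T y).
  { intros x y Hxy. apply (derive_pos_lt T (fun x => / g x)); auto.
    intros u. apply Rinv_0_lt_compat, Hg. }
  intros x. destruct (Rtotal_order (s (T x)) x) as [H|[H|H]]; auto;
    apply Tlt in H; rewrite K in H; lra.
Qed.

Lemma hill_stable_angle (g Q s A : R -> R) :
  (forall x, 0 < g x) -> (forall x, continuous g x) ->
  (forall t, is_derive s t (g (s t))) ->
  (forall t, A t = Q (s t)) ->
  (exists C, 0 <= C /\
    forall x y, solves_system (fun s => / g s) (fun s => Q s / g s) x y ->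
    forall z, s 0 <= z ->
      Rabs (x z) <= C * (Rabs (x (s 0)) + Rabs (y (s 0))) /\
      Rabs (y z) <= C * (Rabs (x (s 0)) + Rabs (y (s 0)))) ->
  hill_stable A.
Proof.
  intros Hg Hc Hs HA [C [HC Hb]] eps Heps.
  destruct (time_inverse_ex g s Hg Hc Hs) as [T [HT [TK SK]]].
  (* The [+ 1] covers [C = 0] and makes [2 C delta < eps] strict. *)
  assert (Hdel : 0 < eps / (2 * C + 1)) by (apply Rdiv_lt_0_compat; lra).
  exists (eps / (2 * C + 1)). split; [exact Hdel|].
  set (del := eps / (2 * C + 1)) in *.
  intros xi Hxi H0 H1 t Ht.
  destruct (Hb (fun z => xi (T z)) (fun z => Derive xi (T z))) with (z := s t)
    as [B1 B2].
  - intros z. destruct (Hxi (T z)) as [D1 D2]. apply Derive_correct in D1.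
    split.
    + rewrite Rmult_comm. apply is_derive_compose; [exact D1|apply HT].
    + eapply is_derive_eq.
      * apply (is_derive_compose (Derive xi)); [exact D2|apply HT].
      * cbv beta. rewrite HA, SK. specialize (Hg z). field. lra.
  - apply (derive_nonneg_le s (fun t => g (s t))); auto.
    intros u _. apply Rlt_le, Hg.
  - cbv beta in B1, B2. rewrite !TK in B1, B2.
    assert (C * (Rabs (xi 0) + Rabs (Derive xi 0)) < eps).
    { apply Rle_lt_trans with (C * (del + del)).
      - apply Rmult_le_compat_l; lra.
      - replace eps with (del * (2 * C + 1)) by (unfold del; field; lra). lra. }
    lra.
Qed.

Lemma sup_norm_max (f : R -> R) (M : R) :
  (forall t, Rabs (f t) <= M) -> (exists t, Rabs (f t) = M) ->
  sup_norm f = Finite M.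
Proof.
  intros Hle [t0 Ht0]. apply is_lub_Rbar_unique. split.
  - intros r [t ->]. apply Hle.
  - intros r Hr. apply Hr. now exists t0.
Qed.

Lemma small_amplitude_conditions (n A B D : R) :
  1 <= n -> 0 < A -> 0 < B -> 0 <= D ->
  2 * (2 + n * PI) * D < 3 * PI * n ^ 3 * B ->
  exists r0, 0 < r0 /\ forall r, 0 < r <= r0 ->
    n * PI * (B * r / A) + D * r / (n ^ 2 * A) / 2 < PI /\
    n * PI / 4 * (D * r / (n ^ 2 * A)) + D * r / (n ^ 2 * A) / 2
      + n * PI / 2 * (B * r / A) ^ 2 < 3 / 8 * n * PI * (B * r / A).
Proof.
  intros Hn HA HB HD Hmain. pose proof PI_RGT_0 as HPI.
  (* The margin in the hypothesis on [D], divided by [8 n^2]: the first-order coefficient, in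
     [r / A], of the second inequality. *)
  set (kappa := 3 / 8 * n * PI * B - n * PI / 4 * (D / n ^ 2) - D / n ^ 2 / 2).
  assert (Hk : 0 < kappa).
  { replace kappa with ((3 * PI * n ^ 3 * B - 2 * (2 + n * PI) * D) / (8 * n ^ 2))
      by (unfold kappa; field; lra).
    apply Rdiv_lt_0_compat; nra. }
  set (L := n * PI * B + D / n ^ 2 / 2).
  assert (HnB : 0 < n * PI * B) by (apply Rmult_lt_0_compat; [apply Rmult_lt_0_compat|]; lra).
  assert (HL : 0 < L).
  { unfold L. assert (0 <= D / n ^ 2) by (apply Rdiv_le_0_compat; nra). lra. }
  (* [r1] keeps the first sum at most [PI / 2]; [r2] lets the quadratic term consume at most half of
     [kappa]. *)
  set (r1 := PI * A / (2 * L)). set (r2 := kappa * A / (n * PI * B ^ 2)).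
  assert (H1 : 0 < r1) by (apply Rdiv_lt_0_compat; nra).
  assert (H2 : 0 < r2) by (apply Rdiv_lt_0_compat; nra).
  exists (Rmin r1 r2). split; [now apply Rmin_glb_lt|].
  intros r [Hr Hle].
  assert (Hr1 : r <= r1) by (eapply Rle_trans; [exact Hle|apply Rmin_l]).
  assert (Hr2 : r <= r2) by (eapply Rle_trans; [exact Hle|apply Rmin_r]).
  split.
  - apply (Rmult_le_compat_r (L / A)) in Hr1; [|apply Rlt_le, Rdiv_lt_0_compat; lra].
    replace (r1 * (L / A)) with (PI / 2) in Hr1 by (unfold r1; field; lra).
    replace (_ + _) with (r * (L / A)) by (unfold L; field; lra). lra.
  - apply (Rmult_le_compat_r (n * PI / 2 * B ^ 2 / A)) in Hr2.
    2: { apply Rlt_le, Rdiv_lt_0_compat; [nra|lra]. }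
    replace (r2 * _) with (kappa / 2) in Hr2 by (unfold r2; field; lra).
    apply Rminus_lt.
    replace (_ - _) with (r / A * (r * (n * PI / 2 * B ^ 2 / A) - kappa))
      by (unfold kappa; field; lra).
    assert (0 < r / A) by (apply Rdiv_lt_0_compat; lra). nra.
Qed.

Theorem theorem4p5 :
  forall (gamma : R) (k l m : nat),
    0 < gamma ->
    (1 <= k <= 14)%nat ->
    (1 <= l <= 2)%nat ->
    (gamma * nu l + abar l) / (gamma * mu k + a k) = (INR m + 1) ^ 2 ->
    2 * (2 + (INR m + 1) * PI) * d l k < 3 * PI * (INR m + 1) ^ 3 * b k ->
    exists (Ekl : R) (Lambda : R -> R),
      0 < Ekl /\
      (forall x, 0 <= x -> 0 <= Lambda x) /\
      (forall x y, 0 <= x -> x < y -> Lambda x < Lambda y) /\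
      Lambda 0 = 0 /\
      forall (phi0 phi1 : R) (phi : R -> R),
        0 < energy gamma k phi0 phi1 ->
        longitudinal_mode gamma k phi0 phi1 phi ->
        (energy gamma k phi0 phi1 <= Ekl -> torsionally_stable gamma l k phi) /\
        (energy gamma k phi0 phi1 <= Ekl <->
         Rbar_le (Rbar_mult (sup_norm phi) (sup_norm phi)) (Lambda Ekl)).
Proof.
  intros gamma k l m Hgamma [Hk _] _ Hratio Hineq.
  set (A := gamma * mu k + a k) in *. set (B := b k) in *. set (D := d l k) in *.
  set (n := INR m + 1) in *.
  assert (HA : 0 < A).
  { pose proof (a_nonneg k Hk). pose proof (Rmult_lt_0_compat _ _ Hgamma (mu_pos k Hk)).
    unfold A. lra. }
  assert (HB : 0 < B) by now apply b_pos.
  assert (HD : 0 <= D) by now apply d_nonneg.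
  assert (Hn : 1 <= n) by (unfold n; pose proof (pos_INR m); lra).
  assert (HnA : gamma * nu l + abar l = n ^ 2 * A) by (rewrite <- Hratio; field; lra).
  destruct (small_amplitude_conditions n A B D) as [r0 [Hr0 Hsmall]]; auto.
  (* The energy of a mode of squared amplitude [r0]. *)
  set (E0 := A * r0 / 2 + B * r0 ^ 2 / 4).
  assert (HE0 : 0 < E0).
  { unfold E0. pose proof (Rmult_lt_0_compat _ _ HA Hr0).
    pose proof (Rmult_lt_0_compat _ _ HB (pow_lt _ 2 Hr0)). lra. }
  assert (Hinc := amplitude2_lt A B HB).
  (* [Lambda] sends an energy to the squared sup-norm of its mode, so the equivalence reduces to
     strict monotonicity. *)
  exists E0, (amplitude2 A B).
  split; [exact HE0|].
  split; [intros x Hx; now apply amplitude2_nonneg|].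
  split; [exact Hinc|].
  split; [now apply amplitude2_0|].
  intros phi0 phi1 phi HE [Hphi [Hp0 Hp1]].
  set (E := energy gamma k phi0 phi1) in *.
  set (r := amplitude2 A B E).
  assert (Hr : 0 < r).
  { unfold r. rewrite <- (amplitude2_0 A B HA HB). apply Hinc; lra. }
  assert (Er : A * r / 2 + B * r ^ 2 / 4 = E) by (apply amplitude2_energy; lra).
  destruct (duffing_angle A B HA HB phi E HE Hphi) as [s [Ds Hs]].
  { rewrite Hp0, Hp1. reflexivity. }
  fold r in Ds, Hs.
  set (u := D * r / (n ^ 2 * A)). set (w := B * r / A) in *.
  assert (Hu : 0 <= u).
  { apply Rdiv_nonneg; apply Rmult_le_pos; try lra. nra. }
  assert (Hw : 0 <= w) by (apply Rdiv_nonneg; nra).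
  assert (Hg := speed_pos A w HA Hw). assert (Hgc := speed_continuous A w HA Hw).
  assert (Err : sqrt r * sqrt r = r) by (apply sqrt_sqrt; lra).
  split.
  - intros HEle.
    apply (hill_stable_angle (speed A w) (hill_angle n A u) s); auto.
    + intros t. unfold hill_coeff, hill_angle. fold D. rewrite Hs, HnA.
      transitivity (n ^ 2 * A + D * (sqrt r * sqrt r * cos (s t) ^ 2)); [ring|].
      rewrite Err. unfold u. field. lra.
    + destruct (Hsmall r) as [Hlow Hup].
      { split; [exact Hr|]. apply Rnot_lt_le. intros Hlt.
        assert (r0 ^ 2 < r ^ 2) by nra. unfold E0 in HEle. nra. }
      apply (hill_angle_system_bounded n A u w Hn HA Hu Hw m (s 0)); auto.
  - destruct (time_inverse_ex _ _ Hg Hgc Ds) as [T [_ [_ ST]]].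
    assert (Hsup : sup_norm phi = Finite (sqrt r)).
    { apply sup_norm_max.
      - intros t. rewrite Hs, Rabs_mult, (Rabs_pos_eq (sqrt r)) by apply sqrt_pos.
        rewrite <- (Rmult_1_r (sqrt r)) at 2.
        apply Rmult_le_compat_l; [apply sqrt_pos|apply Rabs_le, COS_bound].
      - exists (T 0). rewrite Hs, ST, cos_0, Rmult_1_r. apply Rabs_pos_eq, sqrt_pos. }
    rewrite Hsup. simpl. rewrite Err. unfold r. split; intros H.
    + destruct H as [H|<-]; [|lra]. apply Rlt_le, Hinc; lra.
    + apply Rnot_lt_le. intros Hlt. apply Hinc in Hlt; lra.
Qed.
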